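(* Let the vector field $\mathbf{f}$ of the autonomous equation $\mathbf{x}'(t)=\mathbf{f}(\mathbf{x}(t))$ and its derivatives up to order $2$ be functions defined and bounded on $\mathbb{R}^d$. Then LLRK discretizations $\mathbf{y}_{n+1}=\mathbf{y}_n+h\boldsymbol{\varphi}_\gamma(\mathbf{y}_n,h)$ are linearization preserving.
   Context: Let an explicit $s$-stage Runge-Kutta scheme of order $\gamma>2$ with coefficients $c_i,a_{ij},b_i$ be given. For the autonomous ODE $\mathbf{x}'=\mathbf{f}(\mathbf{x})$ in $\mathbb{R}^d$, with Jacobian $\mathbf{f}_{\mathbf{x}}$, the order $\gamma$ Local Linearization-Runge Kutta (LLRK) discretization with uniform step $h>0$ is $$\mathbf{y}_{n+1}=\mathbf{y}_n+h\boldsymbol{\varphi}_\gamma(\mathbf{y}_n,h),\qquad \boldsymbol{\varphi}_\gamma(\boldsymbol{\xi},\delta)=\Phi(\boldsymbol{\xi},\delta)\mathbf{f}(\boldsymbol{\xi})+\sum_{i=1}^s b_i\mathbf{k}_i(\boldsymbol{\xi},\delta),$$ where $$\Phi(\boldsymbol{\xi},\delta)=\frac1\delta\int_0^\delta e^{\mathbf{f}_{\mathbf{x}}(\boldsymbol{\xi})u}du,\qquad \mathbf{k}_i(\boldsymbol{\xi},\delta)=\mathbf{q}\Big(\boldsymbol{\xi};c_i\delta,\delta\sum_{j=1}^{i-1}a_{ij}\mathbf{k}_j(\boldsymbol{\xi},\delta)\Big),$$ $$\mathbf{q}(\boldsymbol{\xi};\delta,\mathbf{u})=\mathbf{f}(\boldsymbol{\xi}+\delta\Phi(\boldsymbol{\xi},\delta)\mathbf{f}(\boldsymbol{\xi})+\mathbf{u})-\mathbf{f}_{\mathbf{x}}(\boldsymbol{\xi})\delta\Phi(\boldsymbol{\xi},\delta)\mathbf{f}(\boldsymbol{\xi})-\mathbf{f}(\boldsymbol{\xi}),$$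 with $\delta\Phi(\boldsymbol{\xi},\delta)$ read as $\mathbf{0}$ at $\delta=0$. A one-step integrator $\mathbf{u}_n\mapsto\mathbf{u}_{n+1}$ with step $h$ is linearization preserving at an equilibrium point $\boldsymbol{\xi}$ of the ODE (i.e. $\mathbf{f}(\boldsymbol{\xi})=\mathbf{0}$) if, expanding around $\boldsymbol{\xi}$, $$\mathbf{u}_{n+1}-\boldsymbol{\xi}=e^{h\mathbf{f}_{\mathbf{x}}(\boldsymbol{\xi})}(\mathbf{u}_n-\boldsymbol{\xi})+O(\Vert\mathbf{u}_n-\boldsymbol{\xi}\Vert^2)$$ as $\mathbf{u}_n\to\boldsymbol{\xi}$. It is linearization preserving if it is so at all equilibrium points of the ODE. *)

(* Defs.v *)
From HB Require Import structures.
From mathcomp Require Import all_boot all_order all_algebra.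
From mathcomp Require Import all_classical all_reals all_analysis.

Set Implicit Arguments.
Unset Strict Implicit.
Unset Printing Implicit Defensive.

Import Order.TTheory GRing.Theory Num.Theory.
Import numFieldNormedType.Exports.

Local Open Scope classical_set_scope.
Local Open Scope ring_scope.

(** Points of R^d are column vectors, so that matrices act on the left as in
    [A *m v]; the norm [`|v|] is the library's sup norm. *)

Section Derivatives.
Context {R : realType}.

(** [f] and all its iterated derivatives of order at most [k] along directions
    taken in [D] exist everywhere and satisfy [P]. *)
Fixpoint derivatives_upto {U V : normedModType R} (D : set U)
    (P : (U -> V) -> Prop) (k : nat) (f : U -> V) : Prop :=
  P f /\ (if k is k'.+1 then
            forall v, D v -> (forall x, derivable f x v) /\
                             derivatives_upto D P k' ('D_v f)
          else True).

Definition unit_vector {d : nat} (j : 'I_d) : 'cV[R]_d := delta_mx j 0.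

Definition bounded_partials_upto {d : nat} (k : nat)
    (f : 'cV[R]_d -> 'cV[R]_d) : Prop :=
  derivatives_upto (range unit_vector) (fun g => bounded_fun g) k f.

Definition smooth {U V : normedModType R} (f : U -> V) : Prop :=
  forall k, derivatives_upto setT (fun g => continuous g) k f.

(** The library's ['J f] acts on row vectors, i.e. it is the transpose of
    the matrix of partial derivatives. *)
Definition Jacobian {d : nat} (f : 'cV[R]_d -> 'cV[R]_d) (x : 'cV[R]_d) :
  'M[R]_d := \matrix_(i, j) ('D_(unit_vector j) f x) i 0.

Definition expmx {d : nat} (A : 'M[R]_d) : 'M[R]_d :=
  limn (series (fun k => (k`!%:R)^-1 *: A ^+ k)).

(** [\int_0^x F u du], oriented: the abscissae [c_i] of a Runge-Kutta scheme,
    hence the upper bound [x], may be negative. *)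
Definition integral_from0 (F : R -> R) (x : R) : R :=
  if 0 <= x then \int[@lebesgue_measure R]_(u in `[0, x]) F u
  else - \int[@lebesgue_measure R]_(u in `[x, 0]) F u.

End Derivatives.

Section ExplicitStages.
Context {V : nmodType} (s : nat).

(** When [F i k] only depends on the [k j] with [j < i], this is the unique
    solution of [k i = F i k], see [explicit_stagesE]. *)
Definition explicit_stages (F : 'I_s -> ('I_s -> V) -> V) : 'I_s -> V :=
  iter s (fun k i => F i k) (fun=> 0).

Lemma explicit_stagesE (F : 'I_s -> ('I_s -> V) -> V) (i : 'I_s) :
  (forall (i : 'I_s) k k', (forall j : 'I_s, (j < i)%N -> k j = k' j) ->
     F i k = F i k') ->
  explicit_stages F i = F i (explicit_stages F).
Proof.
move=> loc; pose G k := fun i => F i k : V.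
suff stable n m (j : 'I_s) : (j < n)%N -> (j < m)%N ->
    iter n G (fun=> 0) j = iter m G (fun=> 0) j.
  by apply: (stable s s.+1 i); rewrite ?ltnS ?(ltnW (ltn_ord i)).
elim: n m j => [//|n IH] [//|m] j jn jm /=.
apply: loc => l lj.
by apply: IH; [exact: leq_trans lj jn | exact: leq_trans lj jm].
Qed.

End ExplicitStages.

(** Only the entries [rk_a i j] with [j < i] are ever used. *)
Record rk_scheme (R : realType) (s : nat) := RKScheme {
  rk_c : 'I_s -> R;
  rk_a : 'I_s -> 'I_s -> R;
  rk_b : 'I_s -> R }.

Section RungeKutta.
Context {R : realType} {s : nat} (RK : rk_scheme R s).

Section Step.
Context {m : nat} (g : R * 'cV[R]_m -> 'cV[R]_m) (t h : R) (y : 'cV[R]_m).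

Definition rk_stage : 'I_s -> 'cV[R]_m := explicit_stages (fun i k =>
  g (t + rk_c RK i * h, y + h *: \sum_(j < s | (j < i)%N) rk_a RK i j *: k j)).

Lemma rk_stageE i : rk_stage i =
  g (t + rk_c RK i * h,
     y + h *: \sum_(j < s | (j < i)%N) rk_a RK i j *: rk_stage j).
Proof.
rewrite {1}/rk_stage explicit_stagesE // => {}i k k' kk'.
by congr (g (_, _ + _ *: _)); apply: eq_bigr => j /kk' ->.
Qed.

Definition rk_step : 'cV[R]_m := y + h *: \sum_i rk_b RK i *: rk_stage i.

End Step.

(** Order (at least) [p]: on every smooth initial value problem
    [x' = g(t, x)], of any dimension, the local error is [O(h^(p+1))]. *)
Definition rk_order (p : nat) : Prop :=
  forall (m : nat) (g : R * 'cV[R]_m -> 'cV[R]_m) (x : R -> 'cV[R]_m) (t0 : R),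
    smooth g ->
    (\forall t \near t0, is_derive t (1 : R) x (g (t, x t))) ->
    (fun h : R => x (t0 + h) - rk_step g t0 h (x t0))
      =O_ ((0 : R)^'+) (fun h : R => h ^+ p.+1).

End RungeKutta.

Section LocalLinearization.
Context {R : realType} {d : nat} (f : 'cV[R]_d -> 'cV[R]_d).
Implicit Types (xi u : 'cV[R]_d) (delta : R).

(** At [delta = 0] the inverse [0^-1] is [0], so [delta *: Phi xi delta] is
    then [0]. *)
Definition Phi xi delta : 'M[R]_d := delta^-1 *:
  \matrix_(i, j)
    integral_from0 (fun u : R => expmx (u *: Jacobian f xi) i j) delta.

Definition ll_q xi delta u : 'cV[R]_d :=
  let z := (delta *: Phi xi delta) *m f xi in
  f (xi + z + u) - Jacobian f xi *m z - f xi.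

Context {s : nat} (RK : rk_scheme R s).

Definition llrk_stage xi delta : 'I_s -> 'cV[R]_d :=
  explicit_stages (fun i k =>
    ll_q xi (rk_c RK i * delta)
         (delta *: \sum_(j < s | (j < i)%N) rk_a RK i j *: k j)).

Lemma llrk_stageE xi delta i : llrk_stage xi delta i =
  ll_q xi (rk_c RK i * delta)
       (delta *: \sum_(j < s | (j < i)%N) rk_a RK i j *: llrk_stage xi delta j).
Proof.
rewrite {1}/llrk_stage explicit_stagesE // => {}i k k' kk'.
by congr (ll_q _ _ (_ *: _)); apply: eq_bigr => j /kk' ->.
Qed.

Definition llrk_phi xi delta : 'cV[R]_d :=
  Phi xi delta *m f xi + \sum_i rk_b RK i *: llrk_stage xi delta i.

Definition llrk_step (h : R) (y : 'cV[R]_d) : 'cV[R]_d :=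
  y + h *: llrk_phi y h.

End LocalLinearization.

Section LinearizationPreserving.
Context {R : realType} {d : nat} (f : 'cV[R]_d -> 'cV[R]_d).

Definition equilibrium (xi : 'cV[R]_d) : Prop := f xi = 0.

(** [Psi] is the one-step map [u_n |-> u_(n+1)] of an integrator with
    step [h]. *)
Definition linearization_preserving_at (h : R) (Psi : 'cV[R]_d -> 'cV[R]_d)
    (xi : 'cV[R]_d) : Prop :=
  (fun u : 'cV[R]_d =>
     (Psi u - xi) - expmx (h *: Jacobian f xi) *m (u - xi))
    =O_ xi (fun u : 'cV[R]_d => `|u - xi| ^+ 2).

Definition linearization_preserving (h : R) (Psi : 'cV[R]_d -> 'cV[R]_d) :
    Prop :=
  forall xi, equilibrium xi -> linearization_preserving_at h Psi xi.

End LinearizationPreserving.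

(* Main.v *)
Require Import Defs.
From mathcomp Require Import all_boot all_order all_algebra.
From mathcomp Require Import all_classical all_reals all_analysis.
From mathcomp Require Import ring lra.
Import Order.TTheory GRing.Theory Num.Theory.
Import numFieldNormedType.Exports.

(** Write [J u] for the Jacobian of [f] at [u] and [e = |u - xi|] with
    [f xi = 0]. The bounded second partials make [J] Lipschitz and give
    [f u = J u (u - xi) + O(e^2)]. As [h Phi(u, h) J u = exp (h J u) - 1], the
    exponential part of the step is
    [h Phi(u, h) f u = (exp (h J u) - 1) (u - xi) + O(e^2)], and [J u] may be
    replaced by [J xi] in it since [exp] is locally Lipschitz. The Runge-Kutta
    part is negligible: in [q] the linear part of [f] along [z = O(e)] cancels,
    so that [q(u; x, w) = J u w + O(|z + w|^2)], and by induction every stage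
    is [O(e^2)]. *)

Set Implicit Arguments.
Unset Strict Implicit.
Unset Printing Implicit Defensive.

Local Open Scope classical_set_scope.
Local Open Scope ring_scope.

(** * Sup-norm bounds for products and powers of matrices *)

Section MatrixNorm.
Context {R : realType}.

Lemma le_entry_mx_norm {m n : nat} (A : 'M[R]_(m, n)) i j : `|A i j| <= `|A|.
Proof.
rewrite [leRHS]/Num.Def.normr/= mx_normrE.
exact: (le_bigmax _ (fun ij : 'I_m * 'I_n => `|A ij.1 ij.2|) (i, j)).
Qed.

Lemma mx_norm_le {m n : nat} (A : 'M[R]_(m, n)) (e : R) :
  0 <= e -> (forall i j, `|A i j| <= e) -> `|A| <= e.
Proof.
move=> e0 Ae; rewrite [leLHS]/Num.Def.normr/= mx_normrE.
by apply: bigmax_le => // -[i j] _; exact: Ae.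
Qed.

Lemma sum_norm_le {n : nat} (F : 'I_n -> R) (e : R) :
  (forall i, `|F i| <= e) -> `|\sum_i F i| <= n%:R * e.
Proof.
move=> Fe; apply: le_trans (ler_norm_sum _ _ _) _.
apply: le_trans (ler_sum _ (fun i _ => Fe i)) _.
by rewrite sumr_const card_ord mulr_natl.
Qed.

Lemma mx_norm_mul {m n p : nat} (A : 'M[R]_(m, n)) (B : 'M[R]_(n, p)) :
  `|A *m B| <= n%:R * (`|A| * `|B|).
Proof.
apply: mx_norm_le => [|i j]; first by rewrite !mulr_ge0.
rewrite mxE; apply: sum_norm_le => k.
by rewrite normrM ler_pM ?le_entry_mx_norm.
Qed.

(** The sup norm is submultiplicative only up to the factor [d], hence [d%:R * M]. The summand 1
    keeps the base at least 1, so that exponents may be raised later. *)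
Lemma mx_norm_exp {d : nat} (A : 'M[R]_d) (M : R) (k : nat) :
  `|A| <= M -> `|A ^+ k| <= (d%:R * M + 1) ^+ k.
Proof.
move=> AM; have M0 : 0 <= M by exact: le_trans AM.
have b0 : 0 <= d%:R * M by rewrite mulr_ge0.
elim: k => [|k IH].
  rewrite !expr0; apply: mx_norm_le => // i j.
  by rewrite mxE; case: eqP => _; rewrite ?normr1 ?normr0.
rewrite !exprS; apply: le_trans (mx_norm_mul _ _) _.
rewrite mulrA ler_pM ?mulr_ge0//.
by rewrite (@le_trans _ _ (d%:R * M)) ?ler_wpM2l// lerDl.
Qed.

(** Induction on A^(k+1) - B^(k+1) = A (A^k - B^k) + (A - B) B^k. The factor 2^k absorbs the linear
    growth in [k] of the telescoping sum, so the bound stays geometric and sums to an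
    exponential. *)
Lemma mx_norm_subX {d : nat} (A B : 'M[R]_d) (M : R) (k : nat) :
  `|A| <= M -> `|B| <= M ->
  `|A ^+ k - B ^+ k| <= d%:R * `|A - B| * (2 * (d%:R * M + 1)) ^+ k.
Proof.
move=> AM BM; have M0 : 0 <= M by exact: le_trans AM.
have dM0 : 0 <= d%:R * M by rewrite mulr_ge0.
set b := d%:R * M + 1; have b1 : 1 <= b by rewrite lerDr.
have b0 : 0 <= b by exact: le_trans b1.
elim: k => [|k IH]; first by rewrite subrr normr0 !mulr_ge0.
have -> : A ^+ k.+1 - B ^+ k.+1 = A * (A ^+ k - B ^+ k) + (A - B) * B ^+ k.
  by rewrite !exprS mulrBr mulrBl addrA subrK.
set D := d%:R * `|A - B|; have D0 : 0 <= D by rewrite mulr_ge0.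
apply: le_trans (ler_normD _ _) _.
(* The doubled base gives one half of the bound to each of the two terms. *)
have -> : D * (2 * b) ^+ k.+1 = b * (D * (2 * b) ^+ k) + D * (b * (2 * b) ^+ k).
  by rewrite exprS; ring.
apply: lerD; apply: le_trans (mx_norm_mul _ _) _; rewrite mulrA.
- apply: ler_pM; rewrite ?mulr_ge0//.
  by rewrite (@le_trans _ _ (d%:R * M)) ?ler_wpM2l// lerDl.
- apply: ler_wpM2l => //; apply: le_trans (mx_norm_exp k BM) _.
  rewrite -/b -[leLHS]mul1r ler_pM ?exprn_ge0// lerXn2r ?nnegrE ?mulr_ge0//.
  lra.
Qed.

End MatrixNorm.

(** * The matrix exponential: entries and Lipschitz bound *)

Section MatrixExponential.
Context {R : realType}.

Lemma normed_series_dominated {V : normedModType R} (c : V ^nat) (C b : R) :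
  0 <= b -> 0 <= C -> (forall k, `|c k| <= C * (b ^+ k / k`!%:R)) ->
  cvgn [normed series c].
Proof.
move=> b0 C0 cb; apply: (@series_le_cvg _ _ (C *: exp_coeff b)) => //.
- by move=> k; exact: normr_ge0.
- by move=> k; apply: mulr_ge0 => //; exact: exp_coeff_ge0.
- exact/is_cvg_seriesZ/is_cvg_series_exp_coeff.
Qed.

Lemma cvg_series_dominated (c : R ^nat) (C b : R) :
  0 <= b -> 0 <= C -> (forall k, `|c k| <= C * (b ^+ k / k`!%:R)) ->
  cvgn (series c).
Proof.
by move=> b0 C0 cb; exact/normed_cvg/(normed_series_dominated b0 C0 cb).
Qed.

Lemma lim_series_dominated (c : R ^nat) (C b : R) :
  0 <= b -> 0 <= C -> (forall k, `|c k| <= C * (b ^+ k / k`!%:R)) ->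
  `|limn (series c)| <= C * expR b.
Proof.
move=> b0 C0 cb; have cvc := normed_series_dominated b0 C0 cb.
apply: le_trans (lim_series_norm cvc) _.
have cve : cvgn (series (exp_coeff b)) by exact: is_cvg_series_exp_coeff.
have -> : C * expR b = limn (series (C *: exp_coeff b)).
  by rewrite lim_seriesZ// /expR.
by apply: lim_series_le => //; exact: is_cvg_seriesZ.
Qed.

Lemma cvg_mx {T : Type} (F : set_system T) {FF : Filter F} {m n : nat}
  (M : T -> 'M[R]_(m, n)) (L : 'M[R]_(m, n)) :
  (forall i j, M t i j @[t --> F] --> L i j) -> M t @[t --> F] --> L.
Proof.
move=> ML; apply/cvgrPdist_le => e e0.
have ML' : \forall t \near F, forall ij : 'I_m * 'I_n,
    `|L ij.1 ij.2 - M t ij.1 ij.2| <= e.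
  by apply: filter_forall => ij; move/cvgrPdist_le : (ML ij.1 ij.2); exact.
apply: filterS ML' => t Lt; apply: mx_norm_le => [|i j]; first exact: ltW.
by rewrite !mxE; exact: (Lt (i, j)).
Qed.

Lemma fact_scale_le {x b C : R} (k : nat) : `|x| <= C * b ^+ k ->
  `|(k`!%:R)^-1 * x| <= C * (b ^+ k / k`!%:R).
Proof.
move=> xb; rewrite normrM ger0_norm ?invr_ge0// mulrA mulrC.
by rewrite ler_wpM2r ?invr_ge0.
Qed.

(** Every entry series is dominated by an exponential series, hence converges. As there are finitely
    many entries, the matrix series converges in the sup norm, so [limn] in [expmx] is a true limit
    and may be taken entrywise. *)
Lemma expmxE {d : nat} (A : 'M[R]_d) i j :
  expmx A i j = limn (series (fun k => (k`!%:R)^-1 * (A ^+ k) i j)).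
Proof.
pose L := \matrix_(i, j) limn (series (fun k => (k`!%:R)^-1 * (A ^+ k) i j)).
have -> : expmx A = L; last by rewrite mxE.
apply: cvg_lim => //; apply: cvg_mx => {}i {}j; rewrite mxE.
rewrite (_ : (fun n => _) = series (fun k => (k`!%:R)^-1 * (A ^+ k) i j)).
  apply: (@cvg_series_dominated _ 1 (d%:R * `|A| + 1)) => // k.
  apply: fact_scale_le; rewrite mul1r.
  by apply: le_trans (mx_norm_exp k (lexx _)); exact: le_entry_mx_norm.
apply/funext => n; rewrite /series/= summxE.
by apply: eq_bigr => k _; rewrite mxE.
Qed.

(** Termwise, [mx_norm_subX] dominates the series of the difference by the exponential series at 2
    (d M + 1). *)
Lemma expmx_lipschitz {d : nat} (A B : 'M[R]_d) (M : R) :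
  `|A| <= M -> `|B| <= M ->
  `|expmx A - expmx B| <= d%:R * `|A - B| * expR (2 * (d%:R * M + 1)).
Proof.
move=> AM BM; have M0 : 0 <= M by exact: le_trans AM.
have b0 : 0 <= d%:R * M + 1 by rewrite addr_ge0// mulr_ge0.
have dAB0 : 0 <= d%:R * `|A - B| by rewrite mulr_ge0.
apply: mx_norm_le => [|i j]; first by rewrite mulr_ge0// expR_ge0.
have cve (X : 'M[R]_d) : `|X| <= M ->
    cvgn (series (fun k => (k`!%:R)^-1 * (X ^+ k) i j)).
  move=> XM; apply: (@cvg_series_dominated _ 1 (d%:R * M + 1)) => // k.
  apply: fact_scale_le; rewrite mul1r.
  by apply: le_trans (mx_norm_exp k XM); exact: le_entry_mx_norm.
rewrite !mxE !expmxE -lim_seriesB; [|exact: cve|exact: cve].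
apply: lim_series_dominated => // [|k]; first by rewrite mulr_ge0.
rewrite [X in `|X|](_ : _ = (k`!%:R)^-1 * (A ^+ k - B ^+ k) i j); last first.
  by rewrite !mxE mulrBr.
apply/fact_scale_le/(le_trans (le_entry_mx_norm _ _ _)).
exact: mx_norm_subX.
Qed.

End MatrixExponential.

(** * The integral of the matrix exponential as a power series *)

Lemma scale_mxX {R : comNzRingType} {d : nat} (x : R) (A : 'M[R]_d) (k : nat) :
  (x *: A) ^+ k = x ^+ k *: A ^+ k.
Proof.
elim: k => [|k IH]; first by rewrite !expr0 scale1r.
rewrite !exprS IH; rewrite -[LHS]/(_ *m _) -[_ * A ^+ k]/(_ *m _).
by rewrite -scalemxAl -scalemxAr scalerA.
Qed.

Section ExponentialIntegral.
Context {R : realType}.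

Lemma integral_from0_FTC (f F : R -> R) (x : R) :
  (forall y : R, is_derive y (1 : R) F (f y)) -> continuous f ->
  integral_from0 f x = F x - F 0.
Proof.
move=> dF cf.
have cF : continuous F.
  by move=> y; apply/differentiable_continuous/derivable1_diffP; case: (dF y).
have ftc a b : a < b ->
    (\int[@lebesgue_measure R]_(u in `[a, b]) f u) = F b - F a.
  move=> ab; rewrite /Rintegral (@continuous_FTC2 _ f F)//.
  - exact: continuous_subspaceT.
  - split=> [y _| |]; first by case: (dF y).
    + exact/cvg_at_right_filter/cF.
    + exact/cvg_at_left_filter/cF.
  - by move=> y _; rewrite derive1E; case: (dF y).
rewrite /integral_from0; case: ltrgt0P => [x0|x0|->].
- exact: ftc.
- by rewrite ftc// opprB.
- by rewrite set_itv1 Rintegral_set1 subrr.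
Qed.

Context {d : nat} (A : 'M[R]_d).

Let b := d%:R * `|A| + 1.

(** Coefficients of the power series in x of the entry (i, j) of A^m exp(x A), the [m]-th derivative
    of exp(x A). *)
Let coef (m : nat) i j (k : nat) : R := (k`!%:R)^-1 * (A ^+ (k + m)) i j.

(** Coefficients of the primitive of exp(x A): the sum of x^(k+1) A^k / (k+1)!. The zero constant
    term makes it vanish at 0. *)
Let prim i j (k : nat) : R :=
  if k is k'.+1 then (k`!%:R)^-1 * (A ^+ k') i j else 0.

Let b_ge0 : 0 <= b. Proof. by rewrite addr_ge0// mulr_ge0. Qed.

Let b_ge1 : 1 <= b. Proof. by rewrite lerDr mulr_ge0. Qed.

Let diffs_prim i j : pseries_diffs (prim i j) = coef 0 i j.
Proof.
apply/funext => k; rewrite /pseries_diffs/= /coef addn0 factS natrM invfM.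
by rewrite !mulrA mulfV ?mul1r.
Qed.

Let diffs_coef m i j : pseries_diffs (coef m i j) = coef m.+1 i j.
Proof.
apply/funext => k; rewrite /pseries_diffs/= /coef factS natrM invfM.
by rewrite !mulrA mulfV ?mul1r// addSnnS.
Qed.

Let cvg_coef m i j x : cvgn (pseries (coef m i j) x).
Proof.
(* Since A^(k+m) is bounded by b^m b^k, the factor b^m goes into the constant. *)
apply: (@cvg_series_dominated _ _ (b ^+ m) (b * `|x|)) => [||k].
- by rewrite mulr_ge0.
- by rewrite exprn_ge0.
rewrite /=/coef -mulrA; apply: fact_scale_le.
rewrite normrM normrX exprMn mulrA -exprD addnC ler_wpM2r ?exprn_ge0//.
exact: le_trans (le_entry_mx_norm _ _ _) (mx_norm_exp _ (lexx _)).
Qed.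

Let prim_le i j x k : `|prim i j k * x ^+ k| <= 1 * ((b * `|x|) ^+ k / k`!%:R).
Proof.
case: k => [|k].
  by rewrite mul0r normr0 mul1r divr_ge0// exprn_ge0// mulr_ge0.
rewrite /prim -mulrA; apply: fact_scale_le.
rewrite mul1r normrM normrX exprMn ler_wpM2r ?exprn_ge0//.
apply: le_trans (le_entry_mx_norm _ _ _) _.
apply: le_trans (mx_norm_exp _ (lexx _)) _.
(* The index shift leaves b^k where b^(k+1) is wanted; 1 <= b closes the gap. *)
by rewrite exprS ler_peMl ?exprn_ge0.
Qed.

Let cvg_prim i j x : cvgn (pseries (prim i j) x).
Proof.
by apply: (cvg_series_dominated _ _ (prim_le i j x)); rewrite ?mulr_ge0.
Qed.

Let expmx_pseries i j x : expmx (x *: A) i j = limn (pseries (coef 0 i j) x).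
Proof.
rewrite expmxE; congr (limn (series _)); apply/funext => k.
by rewrite scale_mxX mxE /= /coef addn0 mulrA mulrAC.
Qed.

Let lt_normD1 (x : R) : `|x| < `| `|x| + 1|.
Proof. by rewrite [ltRHS]ger0_norm ?addr_ge0// ltrDl. Qed.

Let integral_expmx_pseries i j x :
  integral_from0 (fun u : R => expmx (u *: A) i j) x =
  limn (pseries (prim i j) x).
Proof.
have -> : (fun u : R => expmx (u *: A) i j) =
          (fun u => limn (pseries (coef 0 i j) u)).
  by apply/funext => u; exact: expmx_pseries.
have dP (y : R) : is_derive y (1 : R) (fun u => limn (pseries (prim i j) u))
    (limn (pseries (coef 0 i j) y)).
  (* Termwise differentiation at y uses convergence of the series and of its first two formal
     derivatives at a point of larger modulus, here |y| + 1. *)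
  rewrite -diffs_prim; apply: (@pseries_snd_diffs _ _ (`|y| + 1)) => //.
  - by rewrite diffs_prim; exact: cvg_coef.
  - by rewrite diffs_prim diffs_coef; exact: cvg_coef.
have cP : continuous (fun u => limn (pseries (coef 0 i j) u)).
  move=> y; apply/differentiable_continuous/derivable1_diffP.
  suff [] : is_derive y (1 : R) (fun u => limn (pseries (coef 0 i j) u))
    (limn (pseries (coef 1 i j) y)) by [].
  rewrite -(diffs_coef 0); apply: (@pseries_snd_diffs _ _ (`|y| + 1)) => //;
    rewrite ?diffs_coef; exact: cvg_coef.
(* At 0 the primitive has only zero terms: the first by its coefficient, the others by the power of
   0. *)
rewrite (integral_from0_FTC x dP cP) [X in _ - X](_ : _ = 0) ?subr0//.
apply: cvg_lim => //; rewrite (_ : pseries _ _ = cst 0); first exact: cvg_cst.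
apply/funext => n; rewrite /pseries/series/= big1// => -[|k] _.
  by rewrite mul0r.
by rewrite expr0n mulr0.
Qed.

(** Bounding the power series instead of the integral treats both signs of [x] at once. *)
Lemma integral_expmx_le i j (x : R) :
  `|integral_from0 (fun u : R => expmx (u *: A) i j) x| <=
  expR ((d%:R * `|A| + 1) * `|x|).
Proof.
rewrite integral_expmx_pseries -[leRHS]mul1r.
by apply: (lim_series_dominated _ _ (prim_le i j x)); rewrite ?mulr_ge0.
Qed.

(** Multiplying x^(k+1) A^k / (k+1)! by [A] gives the term of index k + 1 of exp(x A), so only the
    identity is missing. The argument covers singular [A]. *)
Lemma integral_expmx_mul (x : R) :
  (\matrix_(i, j) integral_from0 (fun u : R => expmx (u *: A) i j) x) *m A =
  expmx (x *: A) - 1.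
Proof.
apply/matrixP => i j; rewrite !mxE.
under eq_bigr do rewrite mxE integral_expmx_pseries.
have cvS : (fun n => \sum_l pseries (prim i l) x n * A l j) @ \oo -->
    \sum_l limn (pseries (prim i l) x) * A l j.
  apply: cvg_big => [|l _]; first exact: add_continuous.
  by apply: cvgMr_tmp; exact: cvg_prim.
have cvE : (fun n => pseries (coef 0 i j) x n - (i == j)%:R) @ \oo -->
    expmx (x *: A) i j - (i == j)%:R.
  by apply: cvgB; [rewrite expmx_pseries; exact: cvg_coef|exact: cvg_cst].
suff cvS' : (fun n => \sum_l pseries (prim i l) x n * A l j) @ \oo -->
    expmx (x *: A) i j - (i == j)%:R.
  by rewrite -(cvg_lim _ cvS)// -(cvg_lim _ cvS').
apply: cvg_trans cvE; apply: near_eq_cvg.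
(* The partial sums agree exactly from n = 1 on; at n = 0 the sums are empty and the identity entry
   remains. *)
exists 1%N => // -[//|n] _; rewrite /pseries/series/=.
under [RHS]eq_bigr do rewrite mulr_suml.
rewrite exchange_big/= !big_nat_recl//= [X in _ = X + _]big1; last first.
  by move=> l _; rewrite !mul0r.
rewrite /coef invr1 mul1r !expr0 mulr1 mxE addrAC subrr; congr (_ + _).
apply: eq_bigr => k _; rewrite addn0 [A ^+ k.+1]exprSr.
rewrite -[_ * A]/(_ *m _) mxE mulr_sumr mulr_suml.
by apply: eq_bigr => l _; ring.
Qed.

End ExponentialIntegral.

(** * Mean value and Taylor estimates from partial derivatives *)

Section PartialDerivatives.
Context {R : realType} {d : nat}.
Implicit Types (x y : 'cV[R]_d).

(** Both difference quotients are the same function of [h], so derivability along [v] alone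
    suffices. *)
Lemma is_derive_line {V : normedModType R} (g : V -> R) (v x : V) (s : R) :
  derivable g (x + s *: v) v ->
  is_derive s (1 : R) (fun r : R => g (x + r *: v)) ('D_v g (x + s *: v)).
Proof.
move=> dg.
have E : (fun h : R => h^-1 *: (((fun r : R => g (x + r *: v)) \o shift s)
           (h *: (1 : R)) - g (x + s *: v))) =
         (fun h : R => h^-1 *: ((g \o shift (x + s *: v)) (h *: v) -
            g (x + s *: v))).
  apply/funext => h /=; congr (_ *: (g _ - _)).
  by rewrite [h *: 1]mulr1 scalerDl addrCA.
by split; rewrite /derivable /derive /= E.
Qed.

Lemma mean_value_line {V : normedModType R} (g : V -> R) (v x : V) (t : R) :
  (forall y : V, derivable g y v) ->
  exists2 c : R, `|c| <= `|t| &
    g (x + t *: v) - g x = t * 'D_v g (x + c *: v).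
Proof.
move=> dg; have dl s := is_derive_line (dg (x + s *: v)).
have cl : continuous (fun r : R => g (x + r *: v)).
  by move=> s; apply/differentiable_continuous/derivable1_diffP; case: (dl s).
have [t0|t0] := leP 0 t.
- have [c] := MVT_segment t0 (fun s _ => dl s) (continuous_subspaceT cl).
  rewrite in_itv/= => /andP[c0 ct]; rewrite scale0r addr0 subr0 => E.
  by exists c; rewrite ?ger0_norm// E mulrC.
- have [c] := MVT_segment (ltW t0) (fun s _ => dl s) (continuous_subspaceT cl).
  rewrite in_itv/= => /andP[tc c0]; rewrite scale0r addr0 sub0r => E.
  exists c; first by rewrite !ler0_norm ?lerN2// ltW.
  by apply: oppr_inj; rewrite opprB E mulrC mulNr.
Qed.

(** Going from [x] to [y] one coordinate at a time, each move is along a unit vector and the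
    one-dimensional mean value theorem applies. Total differentiability is never invoked. *)
Lemma mean_value_coordinates (g : 'cV[R]_d -> R) x y :
  (forall j z, derivable g z (unit_vector j)) ->
  exists2 c : 'I_d -> 'cV[R]_d, forall j, `|c j - x| <= `|y - x| &
    g y - g x = \sum_j (y j 0 - x j 0) * 'D_(unit_vector j) g (c j).
Proof.
move=> dg.
(* The corners of the path: the first [k] coordinates are those of [y], the others those of [x]. *)
pose p (k : nat) : 'cV[R]_d := \col_i (if (i < k)%N then y i 0 else x i 0).
have p0 : p 0%N = x by apply/colP => i; rewrite mxE.
have pd : p d = y by apply/colP => i; rewrite mxE ltn_ord.
have pS (j : 'I_d) : p j.+1 = p j + (y j 0 - x j 0) *: unit_vector j.
  apply/colP => i; rewrite !mxE ltnS andbT.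
  have [->|ij] := eqVneq i j; first by rewrite leqnn ltnn mulr1 subrKC.
  by rewrite mulr0 addr0 leq_eqVlt (inj_eq val_inj) (negPf ij).
have step (j : 'I_d) : exists c : 'cV[R]_d, `|c - x| <= `|y - x| /\
    g (p j.+1) - g (p j) = (y j 0 - x j 0) * 'D_(unit_vector j) g c.
  rewrite pS; have [c cle E] := mean_value_line (p j) (y j 0 - x j 0) (dg j).
  exists (p j + c *: unit_vector j); split=> //.
  have le_yx (i : 'I_d) : `|y i 0 - x i 0| <= `|y - x|.
    by have := le_entry_mx_norm (y - x) i 0; rewrite !mxE.
  (* Coordinate [j] of the difference is [c]; the earlier ones are those of y - x and the later ones
     are 0. *)
  apply: mx_norm_le => // i k; rewrite !mxE ord1 andbT.
  have [->|ij] := eqVneq i j.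
    by rewrite ltnn mulr1 addrAC subrr add0r (le_trans cle).
  rewrite mulr0 addr0; case: ifP => _; first exact: le_yx.
  by rewrite subrr normr0.
have [c cP] := fin_all_exists step.
exists c => [j|]; first by case: (cP j).
rewrite -p0 -pd -(telescope_sumr (fun k => g (p k)))// big_mkord.
by apply: eq_bigr => j _; have [_ ->] := cP j; rewrite pd p0.
Qed.

Lemma partials_lipschitz (g : 'cV[R]_d -> R) (M : R) x y :
  (forall j z, derivable g z (unit_vector j)) ->
  (forall j z, `|'D_(unit_vector j) g z| <= M) ->
  `|g y - g x| <= d%:R * M * `|y - x|.
Proof.
move=> dg gM; have [c _ ->] := mean_value_coordinates x y dg.
rewrite -mulrA; apply: sum_norm_le => j.
rewrite normrM mulrC ler_pM//.
by have := le_entry_mx_norm (y - x) j 0; rewrite !mxE.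
Qed.

(** Replacing each partial at the intermediate point by the one at [x] costs L |y - x|, and the
    coordinate increment gives the second factor |y - x|. *)
Lemma partials_taylor (g : 'cV[R]_d -> R) (L : R) x y :
  0 <= L ->
  (forall j z, derivable g z (unit_vector j)) ->
  (forall j z z', `|'D_(unit_vector j) g z' - 'D_(unit_vector j) g z| <=
     L * `|z' - z|) ->
  `|g y - g x - \sum_j 'D_(unit_vector j) g x * (y j 0 - x j 0)| <=
  d%:R * L * `|y - x| ^+ 2.
Proof.
move=> L0 dg gL; have [c cx ->] := mean_value_coordinates x y dg.
rewrite -sumrB -mulrA; apply: sum_norm_le => j.
rewrite [X in X - _]mulrC -mulrBl normrM expr2 mulrA ler_pM//.
  by apply: le_trans (gL _ _ _) _; rewrite ler_wpM2l.
by have := le_entry_mx_norm (y - x) j 0; rewrite !mxE.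
Qed.

End PartialDerivatives.

(** * Boundedness, Lipschitz continuity and Taylor bound for the Jacobian *)

Lemma bounded_fun_norm_le {R : realType} {T : Type} {V : normedModType R}
  (g : T -> V) : bounded_fun g -> exists2 M : R, 0 <= M & forall x, `|g x| <= M.
Proof.
(* Every number above [M0] is a bound; this one is also nonnegative. *)
move=> [M0 [_ gM]]; exists (`|M0| + 1) => // x.
by apply: gM => //; rewrite (le_lt_trans (ler_norm _))// ltrDl.
Qed.

Section BoundedPartials.
Context {R : realType} {d : nat} (f : 'cV[R]_d -> 'cV[R]_d).
Hypothesis f_partials : bounded_partials_upto 2 f.

Let unit_range (j : 'I_d) : range (@unit_vector R d) (unit_vector j).
Proof. by exists j. Qed.

Lemma derivable_coord j z i :
  derivable (fun x => f x i 0) z (unit_vector j).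
Proof.
have [_ /(_ _ (unit_range j))[df _]] := f_partials.
exact: (derivable_mxP _ _ _).1 (df z) i 0.
Qed.

Lemma derive_coord j z i :
  'D_(unit_vector j) (fun x => f x i 0) z = Jacobian f z i j.
Proof.
have [_ /(_ _ (unit_range j))[df _]] := f_partials.
by rewrite !mxE derive_mx// mxE.
Qed.

Lemma Jacobian_bounded :
  exists2 M : R, 0 <= M & forall x, `|Jacobian f x| <= M.
Proof.
have [_ H] := f_partials.
have bd (j : 'I_d) : exists M : R, 0 <= M /\
    forall x, `|'D_(unit_vector j) f x| <= M.
  by have [_ [/bounded_fun_norm_le[M M0 MD] _]] := H _ (unit_range j); exists M.
have [M MP] := fin_all_exists bd.
have M0 j : 0 <= M j by case: (MP j).
(* The sum of the finitely many nonnegative bounds serves as a common bound. *)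
exists (\sum_j M j) => [|x]; first by rewrite sumr_ge0.
apply: mx_norm_le => [|i j]; first by rewrite sumr_ge0.
rewrite mxE (le_trans (le_entry_mx_norm _ _ _))//.
have [_ Mj] := MP j; rewrite (le_trans (Mj x))//.
by rewrite (bigD1 j)//= lerDl sumr_ge0.
Qed.

(** Each entry is a first partial of [f] whose own partials are bounded, so [partials_lipschitz]
    applies to it. *)
Lemma Jacobian_lipschitz :
  exists2 L : R, 0 <= L &
    forall x y, `|Jacobian f y - Jacobian f x| <= L * `|y - x|.
Proof.
have [_ H] := f_partials.
have bd (jk : 'I_d * 'I_d) : exists M : R, 0 <= M /\ forall x,
    `|'D_(unit_vector jk.2) ('D_(unit_vector jk.1) f) x| <= M.
  have [_ [_ H1]] := H _ (unit_range jk.1).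
  have [_ [/bounded_fun_norm_le[M M0 MD] _]] := H1 _ (unit_range jk.2).
  by exists M.
have [M MP] := fin_all_exists bd.
have M0 jk : 0 <= M jk by case: (MP jk).
have dS0 : 0 <= d%:R * \sum_jk M jk by rewrite mulr_ge0// sumr_ge0.
exists (d%:R * \sum_jk M jk) => // x y.
apply: mx_norm_le => [|i j]; first by rewrite mulr_ge0.
rewrite !mxE.
have [_ [_ H1]] := H _ (unit_range j).
apply: (@partials_lipschitz _ _ (fun z => ('D_(unit_vector j) f z) i 0)) => k z.
  have [df _] := H1 _ (unit_range k).
  exact: (derivable_mxP _ _ _).1 (df z) i 0.
have [df _] := H1 _ (unit_range k).
have := derive_mx (df z) => /matrixP/(_ i 0); rewrite mxE => <-.
rewrite (le_trans (le_entry_mx_norm _ _ _))//.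
have [_ Mjk] := MP (j, k); rewrite (le_trans (Mjk z))//.
by rewrite (bigD1 (j, k))//= lerDl sumr_ge0.
Qed.

Lemma taylor_Jacobian :
  exists2 T : R, 0 <= T & forall x y,
    `|f y - f x - Jacobian f x *m (y - x)| <= T * `|y - x| ^+ 2.
Proof.
have [L L0 JL] := Jacobian_lipschitz.
have dL0 : 0 <= d%:R * L by rewrite mulr_ge0.
exists (d%:R * L) => // x y; apply: mx_norm_le => [|i k].
  by rewrite mulr_ge0// exprn_ge0.
rewrite ord1 !mxE.
under eq_bigr do rewrite -derive_coord !mxE.
apply: (@partials_taylor _ _ (fun z => f z i 0)) => // [j z|j z z'].
  exact: derivable_coord.
rewrite !derive_coord; apply: le_trans (JL _ _).
by have := le_entry_mx_norm (Jacobian f z' - Jacobian f z) i j; rewrite !mxE.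
Qed.

End BoundedPartials.

(** * A calculus of orders of vanishing at a point *)

Section OrderAtPoint.
Context {R : realType} {d : nat} (xi : 'cV[R]_d).

(** An explicit form of O(|u - xi|^k) on the fixed ball of radius 1: no neighbourhoods need be
    intersected, and a higher order implies a lower one. Order 0 is boundedness on the ball. *)
Definition order_at (k : nat) {m n : nat} (g : 'cV[R]_d -> 'M[R]_(m, n)) :=
  exists2 C : R, 0 <= C &
    forall u, `|u - xi| <= 1 -> `|g u| <= C * `|u - xi| ^+ k.

Lemma order_at_leq (k l m n : nat) (g : 'cV[R]_d -> 'M[R]_(m, n)) :
  (k <= l)%N -> order_at l g -> order_at k g.
Proof.
move=> kl [C C0 gC]; exists C => // u u1.
by apply: le_trans (gC u u1) _; rewrite ler_wpM2l// ler_wiXn2l.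
Qed.

Lemma order_atD (k m n : nat) (g g' : 'cV[R]_d -> 'M[R]_(m, n)) :
  order_at k g -> order_at k g' -> order_at k (fun u => g u + g' u).
Proof.
move=> [C C0 gC] [C' C'0 gC']; exists (C + C') => [|u u1].
  exact: addr_ge0.
by rewrite mulrDl (le_trans (ler_normD _ _))// lerD ?gC ?gC'.
Qed.

Lemma order_atZ (k m n : nat) (a : R) (g : 'cV[R]_d -> 'M[R]_(m, n)) :
  order_at k g -> order_at k (fun u => a *: g u).
Proof.
move=> [C C0 gC]; exists (`|a| * C) => [|u u1]; first exact: mulr_ge0.
by rewrite normrZ -mulrA ler_wpM2l// gC.
Qed.

Lemma order_at_sum (I : finType) (P : pred I) (k m n : nat)
    (g : 'cV[R]_d -> I -> 'M[R]_(m, n)) :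
  (forall i, P i -> order_at k (g^~ i)) ->
  order_at k (fun u => \sum_(i | P i) g u i).
Proof.
(* The condition [P i] is moved inside, so that a constant can be chosen for every index of the
   finite type. *)
move=> gO; have bd i : exists C : R, 0 <= C /\ (P i -> forall u,
    `|u - xi| <= 1 -> `|g u i| <= C * `|u - xi| ^+ k).
  have [/gO[C C0 gC]|nPi] := boolP (P i); first by exists C.
  by exists 0; split.
have [C CP] := fin_all_exists bd.
exists (\sum_(i | P i) C i) => [|u u1].
  by apply: sumr_ge0 => i _; case: (CP i).
rewrite (le_trans (ler_norm_sum _ _ _))// mulr_suml ler_sum// => i Pi.
by have [_ /(_ Pi)] := CP i; exact.
Qed.

Lemma order_atM (k l m n p : nat) (g : 'cV[R]_d -> 'M[R]_(m, n))
    (g' : 'cV[R]_d -> 'M[R]_(n, p)) :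
  order_at k g -> order_at l g' -> order_at (k + l) (fun u => g u *m g' u).
Proof.
move=> [C C0 gC] [C' C'0 gC']; exists (n%:R * (C * C')) => [|u u1].
  by rewrite !mulr_ge0.
rewrite (le_trans (mx_norm_mul _ _))// -mulrA ler_wpM2l//.
by rewrite exprD mulrACA ler_pM ?gC ?gC'.
Qed.

(** Made for the Taylor remainder: quadratic (l = 2) in an increment [w] of order 1, it has order
    2. *)
Lemma order_at_comp_le (k l m n p q : nat) (g : 'cV[R]_d -> 'M[R]_(m, n))
    (w : 'cV[R]_d -> 'M[R]_(p, q)) (C : R) :
  0 <= C -> (forall u, `|u - xi| <= 1 -> `|g u| <= C * `|w u| ^+ l) ->
  order_at k w -> order_at (k * l) g.
Proof.
move=> C0 gw [D D0 wD]; exists (C * D ^+ l) => [|u u1].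
  by rewrite mulr_ge0// exprn_ge0.
rewrite (le_trans (gw u u1))// -mulrA ler_wpM2l// exprM -exprMn.
by rewrite lerXn2r ?nnegrE ?mulr_ge0 ?exprn_ge0// wD.
Qed.

Lemma order_at_eqO (k m n : nat) (g : 'cV[R]_d -> 'M[R]_(m, n)) :
  order_at k g -> g =O_ xi (fun u => `|u - xi| ^+ k).
Proof.
(* [eqO_exP] asks for a positive constant, and [C] may be 0. *)
move=> [C C0 gC]; apply/eqO_exP; exists (C + 1).
  by rewrite ltr_wpDl.
near=> u.
rewrite [X in _ * X]ger0_norm ?exprn_ge0//.
apply: le_trans (gC u _) _; last by rewrite ler_wpM2r ?exprn_ge0// lerDl.
rewrite distrC; near: u; exact: cvgr_dist_le.
Unshelve. all: by end_near. Qed.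

End OrderAtPoint.

(** * Orders of the terms of the scheme at an equilibrium *)

Section LocalLinearizationOrder.
Context {R : realType} {d : nat} (f : 'cV[R]_d -> 'cV[R]_d) (xi : 'cV[R]_d).
Hypothesis f_partials : bounded_partials_upto 2 f.
Hypothesis fxi : equilibrium f xi.

Let J := Jacobian f.

Let order_id : order_at xi 1 (fun u => u - xi).
Proof. by exists 1 => // u _; rewrite mul1r expr1. Qed.

Let order_Jacobian : order_at xi 0 J.
Proof.
have [M M0 JM] := Jacobian_bounded f_partials.
by exists M => // u _; rewrite expr0 mulr1; exact: JM.
Qed.

(** The expansion is made at [u] and evaluated at [xi], where [f] vanishes. This brings in the
    Jacobian at [u], the one contained in [Phi]. *)
Let order_taylor : order_at xi 2 (fun u => f u - J u *m (u - xi)).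
Proof.
have [T T0 fT] := taylor_Jacobian f_partials.
exists T => // u _; rewrite [X in _ * X ^+ _]distrC; apply: le_trans (fT u xi).
rewrite fxi sub0r -(opprB xi u) mulmxN opprK.
by rewrite -normrN opprD.
Qed.

Let order_f : order_at xi 1 f.
Proof.
rewrite (_ : f = fun u => (f u - J u *m (u - xi)) + J u *m (u - xi)).
  apply: order_atD; first exact: order_at_leq order_taylor.
  exact: order_atM order_Jacobian order_id.
by apply/funext => u; rewrite subrK.
Qed.

Lemma scale_PhiE (u : 'cV[R]_d) (x : R) : x != 0 ->
  x *: Phi f u x =
  \matrix_(i, j) integral_from0 (fun v : R => expmx (v *: J u) i j) x.
Proof. by move=> x0; rewrite /Phi scalerA mulfV// scale1r. Qed.

Let order_Phi (x : R) : order_at xi 0 (fun u => x *: Phi f u x).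
Proof.
have [M M0 JM] := Jacobian_bounded f_partials.
exists (expR ((d%:R * M + 1) * `|x|)) => [|u _]; first exact: expR_ge0.
(* [x] will be c_i h, which may be 0; then [x *: Phi f u x] is the zero matrix. *)
rewrite expr0 mulr1; have [->|x0] := eqVneq x 0.
  by rewrite scale0r normr0 expR_ge0.
rewrite scale_PhiE//; apply: mx_norm_le => [|i j]; first exact: expR_ge0.
rewrite mxE (le_trans (integral_expmx_le _ _ _ _))// ler_expR ler_wpM2r//.
by rewrite lerD2r ler_wpM2l// JM.
Qed.

Let order_expmx (h : R) :
  order_at xi 1 (fun u => expmx (h *: J u) - expmx (h *: J xi)).
Proof.
have [M M0 JM] := Jacobian_bounded f_partials.
have [L L0 JL] := Jacobian_lipschitz f_partials.
have hJ u : `|h *: J u| <= `|h| * M by rewrite normrZ ler_wpM2l// JM.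
set E := expR (2 * (d%:R * (`|h| * M) + 1)).
have E0 : 0 <= E by exact: expR_ge0.
exists (d%:R * (`|h| * L) * E) => [|u _]; first by rewrite !mulr_ge0.
apply: le_trans (expmx_lipschitz (hJ u) (hJ xi)) _.
rewrite -/E expr1 [leRHS]mulrAC ler_wpM2r// -mulrA ler_wpM2l//.
by rewrite -scalerBr normrZ -mulrA ler_wpM2l// JL.
Qed.

Let order_ll_q (x : R) (w : 'cV[R]_d -> 'cV[R]_d) :
  order_at xi 2 w -> order_at xi 2 (fun u => ll_q f u x (w u)).
Proof.
move=> wO; have [T T0 fT] := taylor_Jacobian f_partials.
pose z u := (x *: Phi f u x) *m f u.
have zO : order_at xi 1 z by exact: order_atM (order_Phi x) order_f.
(* Adding and subtracting [J u *m w u] exhibits the Taylor remainder at [u] for the increment z + w,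
   of order 1. *)
rewrite (_ : (fun u => _) = fun u =>
    (f (u + z u + w u) - f u - J u *m (z u + w u)) + J u *m w u).
  apply: order_atD; last exact: order_atM order_Jacobian wO.
  apply: (order_at_comp_le (k := 1) (l := 2) (w := fun u => z u + w u) T0).
    move=> u _; have := fT u (u + z u + w u).
    by rewrite (_ : u + z u + w u - u = z u + w u)// addrAC [u + _]addrC addrK.
  by apply: order_atD => //; exact: order_at_leq wO.
apply/funext => u; rewrite /ll_q -/(z u) mulmxDr opprD !addrA subrK.
by rewrite addrAC.
Qed.

Context {s : nat} (RK : rk_scheme R s).

Let order_llrk_stage (h : R) (i : 'I_s) :
  order_at xi 2 (fun u => llrk_stage f RK u h i).
Proof.
(* Strong induction: stage [i] only involves the stages j < i. *)
have [n] := ubnP i; elim: n i => // n IH i; rewrite ltnS => i_n.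
under [X in order_at _ _ X]eq_fun do rewrite llrk_stageE.
apply/order_ll_q/order_atZ.
apply: order_at_sum => j ji; apply: order_atZ.
exact/IH/(leq_trans ji).
Qed.

Lemma llrk_linearization_preserving_at (h : R) :
  h != 0 -> linearization_preserving_at f h (llrk_step f RK h) xi.
Proof.
move=> h0; apply: order_at_eqO.
(* The three terms have order 2 as 0 + 2, as 1 + 1, and by the bound on the stages. *)
rewrite (_ : (fun u => _) = fun u =>
    (h *: Phi f u h) *m (f u - J u *m (u - xi)) +
    (expmx (h *: J u) - expmx (h *: J xi)) *m (u - xi) +
    h *: \sum_i rk_b RK i *: llrk_stage f RK u h i).
  apply: order_atD; first apply: order_atD.
  - exact: order_atM (order_Phi h) order_taylor.
  - exact: order_atM (order_expmx h) order_id.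
  - apply/order_atZ/order_at_sum => i _; apply: order_atZ.
    exact: order_llrk_stage.
apply/funext => u.
have PhiJ : (h *: Phi f u h) *m (J u *m (u - xi)) =
    expmx (h *: J u) *m (u - xi) - (u - xi).
  by rewrite mulmxA scale_PhiE// integral_expmx_mul mulmxBl mul1mx.
rewrite [in RHS]mulmxBr PhiJ [in RHS]mulmxBl -scalemxAl /llrk_step /llrk_phi.
rewrite scalerDr -/J.
(* Here [p] is h Phi f(u), [e1] and [e0] are exp(h J u) and exp(h J xi) applied to u - xi, and [k]
   is the Runge-Kutta sum. *)
have regroup (p e1 e0 k : 'cV[R]_d) :
    u + (p + k) - xi - e0 = p - (e1 - (u - xi)) + (e1 - e0) + k.
  rewrite opprB !addrA [p + u - xi - e1 + e1]subrK [p + u]addrC.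
  by rewrite -!(addrAC _ k).
exact: regroup.
Qed.

End LocalLinearizationOrder.

Theorem theorem10 (R : realType) (d s gamma : nat) (RK : rk_scheme R s)
    (f : 'cV[R]_d -> 'cV[R]_d) (h : R)
    (gamma_gt2 : (2 < gamma)%N) (RK_order : rk_order RK gamma)
    (f_partials : bounded_partials_upto 2 f)
    (h_gt0 : (0 < h)%R) :
  linearization_preserving f h (llrk_step f RK h).
Proof.
by move=> xi fxi; apply: llrk_linearization_preserving_at; rewrite ?gt_eqF.
Qed.
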